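(* Let $G$ be a connected graph whose minimum degree is at least $3$. If $A=\{v_1,v_2,\dots,v_m\}$ is an independent set of $G$ such that $G-A$ is connected, then $$\gamma_M(G)\ \ge\ \frac12\sum_{i=1}^m\bigl(d(v_i)-\varepsilon_i\bigr)+\gamma_M(G-\{v_1,\dots,v_m\}),$$ where $d(v_i)$ is the degree of $v_i$ in $G$ and, for each $i$, $\varepsilon_i=1$ if $d(v_i)\equiv 1\pmod 2$ and $\varepsilon_i=2$ otherwise.
   Context: The maximum genus $\gamma_M(H)$ of a connected graph $H$ is the maximum integer $k$ such that $H$ has a (cellular) embedding in the orientable surface of genus $k$. *)

(* Defs.v *)
From HB Require Import structures.
From mathcomp Require Import all_boot all_order all_algebra all_fingroup.
From mathcomp Require Import zify.
Set Implicit Arguments.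
Unset Strict Implicit.
Unset Printing Implicit Defensive.

(* Finite undirected graphs; loops and parallel edges are allowed.  The order
   of the two ends [endpt e false] and [endpt e true] of an edge is an
   arbitrary labelling and carries no meaning. *)
Record graph := Graph {
  vert : finType;
  edge : finType;
  endpt : edge -> bool -> vert }.

(* The dart (e, b) is the edge e seen from its end [endpt e b]; a loop has two
   darts at the same vertex, so it counts twice in the degree. *)
Definition dart (G : graph) : finType := (edge G * bool)%type.
Definition src (G : graph) (x : dart G) : vert G := endpt x.1 x.2.
Definition opp (G : graph) (x : dart G) : dart G := (x.1, ~~ x.2).

Lemma oppK (G : graph) : involutive (@opp G).
Proof. by case=> e b; rewrite /opp /= negbK. Qed.

Definition deg (G : graph) (v : vert G) : nat :=
  #|[set x : dart G | src x == v]|.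

Definition adj (G : graph) : rel (vert G) :=
  fun u v => [exists x : dart G, (src x == u) && (src (opp x) == v)].

(* The graph without vertices is not connected. *)
Definition connected (G : graph) : Prop :=
  0 < #|vert G| /\ forall u v : vert G, connect (@adj G) u v.

(* In particular no vertex of A carries a loop. *)
Definition independent (G : graph) (A : {set vert G}) : Prop :=
  forall u v, u \in A -> v \in A -> ~~ adj u v.

Section DeleteVertices.
Variables (G : graph) (A : {set vert G}).

Definition del_vert : finType := {v : vert G | v \notin A}.
Definition del_edge : finType := {e : edge G | [forall b, endpt e b \notin A]}.
Definition del_endpt (e : del_edge) (b : bool) : del_vert :=
  exist _ (endpt (val e) b) (forallP (valP e) b).
Definition del_verts : graph := Graph del_endpt.

End DeleteVertices.

(* A cellular embedding of a connected graph in a closed oriented surface is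
   encoded by its rotation system (Heffter-Edmonds): a permutation of the darts
   whose cycles are exactly the sets of darts leaving a common vertex, listing
   them in the cyclic order in which they occur around that vertex. *)
Definition rotation_system (G : graph) (rho : {perm dart G}) : bool :=
  [forall x, porbit rho x == [set y | src y == src x]].

(* Face tracing: traverse x, then leave its head along the dart that follows
   the reverse of x in the rotation. *)
Definition face_perm (G : graph) (rho : {perm dart G}) : {perm dart G} :=
  (perm (can_inj (@oppK G)) * rho)%g.

(* The second term is needed for the graph with one vertex and no edge, whose
   embedding in the sphere has one face, bounded by no dart; a connected graph
   with an edge has no vertex of degree 0. *)
Definition nfaces (G : graph) (rho : {perm dart G}) : nat :=
  #|porbits (face_perm rho)| + #|[set v : vert G | deg v == 0]|.

(* Some cellular embedding has Euler characteristic |V| - |E| + |F| = 2 - 2k. *)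
Definition embeds_in_genus (G : graph) (k : nat) : bool :=
  [exists rho : {perm dart G}, rotation_system rho &&
     (#|vert G| + nfaces rho + 2 * k == #|edge G| + 2)].

(* The bound on k only makes the range finite: see [leq_max_genus]. *)
Definition max_genus (G : graph) : nat :=
  \max_(k < #|edge G|.+1 | embeds_in_genus G k) k.

Lemma leq_max_genus (G : graph) (k : nat) :
  connected G -> embeds_in_genus G k -> k <= max_genus G.
Proof.
case=> V_gt0 _ Gk.
have k_le : k < #|edge G|.+1.
  have /existsP[rho /andP[_ /eqP eq_k]] := Gk.
  by move: V_gt0 eq_k; lia.
exact: (@leq_bigmax_cond _ (fun j : 'I__ => embeds_in_genus G j)
          (fun j => nat_of_ord j) (Ordinal k_le)).
Qed.

Lemma max_genus_attained (G : graph) (k : nat) :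
  connected G -> embeds_in_genus G k -> embeds_in_genus G (max_genus G).
Proof.
move=> Gconn Gk; have := leq_max_genus Gconn Gk; move: (Gk).
rewrite /max_genus; elim/big_ind: _ => [|m n IHm IHn|i Gi _ _] //.
- by rewrite leqn0 => Gk' /eqP <-.
- by rewrite /maxn; case: ifP => _ ? ?; [apply: IHn | apply: IHm].
Qed.

Definition eps (G : graph) (v : vert G) : nat := if odd (deg v) then 1 else 2.

(* Main.v *)
(* Fix a rotation rho on all darts of G and let edges be present or absent: an
   absent edge leaves two half-edges behind, and the faces of the graph formed
   by the present edges are the cycles of [flip E * rho].  Adding an edge is a
   multiplication by a transposition, so it changes the number of faces by one:
   -1 if its two ends lie in different faces, +1 otherwise.

   Start from a maximum genus embedding of G - A, every vertex of A being an
   isolated vertex with its own face, and attach the vertices of A in turn.  The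
   first edge at v merges the face of v into another one.  Two further edges,
   leaving v at consecutive positions, can be added without increasing the
   number of faces, possibly after exchanging these positions: if the first of
   them splits a face, both parts contain v, and the second can be made to merge
   them.  If d(v) is even, one last edge adds at most one face.  Hence each v
   adds at most eps(v) - 2 faces, and Euler's formula gives the genus. *)
Require Import Defs.
From HB Require Import structures.
From mathcomp Require Import all_boot all_order all_algebra all_fingroup.
From mathcomp Require Import zify.
Set Implicit Arguments.
Unset Strict Implicit.
Unset Printing Implicit Defensive.
Import Order.TTheory GRing.Theory Num.Theory.
(* Restores [Defs.opp], which MathComp's [opp] shadows. *)
Import Defs.

(** * Cycles of permutations *)

Section Cycles.
Variable T : finType.
Implicit Types (s t : {perm T}) (x y z : T).

Lemma porbit_closed s (P : pred T) x :
  (forall y, P y -> P (s y)) -> P x -> forall y, y \in porbit s x -> P y.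
Proof.
move=> Ps Px y /porbitP[i ->{y}].
by elim: i => [|i IHi]; rewrite ?perm1 // expgSr permM Ps.
Qed.

Lemma porbit_trans s x y z :
  x \in porbit s y -> y \in porbit s z -> x \in porbit s z.
Proof. by rewrite -!eq_porbit_mem => /eqP-> . Qed.

Lemma porbit_step s x : s x \in porbit s x.
Proof. by rewrite -[s]expg1 mem_porbit. Qed.

Lemma porbit_fixed s x y : s x = x -> x \in porbit s y -> x = y.
Proof.
move=> sx; rewrite porbit_sym => /(@porbit_closed s (pred1 x)) P.
by apply/esym/eqP/P => //= z /eqP->; apply/eqP.
Qed.

Lemma mem_porbit_conj s t x y :
  (t y \in porbit (s ^ t)%g (t x)) = (y \in porbit s x).
Proof.
apply/porbitP/porbitP => -[i].
  by rewrite -conjXg permJ => /perm_inj ->; exists i.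
by move=> ->; exists i; rewrite -conjXg permJ.
Qed.

Lemma card_porbits_conj s t : #|porbits (s ^ t)%g| = #|porbits s|.
Proof.
rewrite -[RHS](card_imset _ (imset_inj (@perm_inj _ t))) -imset_comp.
have Et x : porbit (s ^ t)%g (t x) = [set t y | y in porbit s x].
  apply/setP=> y; rewrite -[y](permKV t) mem_porbit_conj mem_imset //.
  exact: perm_inj.
apply: eq_card => A; apply/imsetP/imsetP => -[x _ ->].
  by exists ((t^-1)%g x); rewrite //= -Et permKV.
by exists (t x).
Qed.

(** Products apply the left factor first: [tperm x y * s] exchanges the successors of [x] and [y],
    splicing two distinct cycles into one. *)
Lemma porbits_merge s x y :
  x \notin porbit s y -> #|porbits (tperm x y * s)%g|.+1 = #|porbits s|.
Proof.
move=> xy; have := porbits_mul_tperm s x y; rewrite /= xy.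
have -> : x != y by apply: contraNneq xy => ->; apply: porbit_id.
lia.
Qed.

Lemma porbits_tperm_le s x y : #|porbits (tperm x y * s)%g| <= #|porbits s|.+1.
Proof. by have /= := porbits_mul_tperm s x y; case: (x != y); lia. Qed.

Lemma porbits_mulC_tperm s x y :
  #|porbits (s * tperm x y)%g| = #|porbits (tperm x y * s)%g|.
Proof.
rewrite -(card_porbits_conj (tperm x y * s)%g (tperm x y)); congr #|porbits _|.
by rewrite conjgE tpermV !mulgA tperm2 mul1g.
Qed.

Lemma tperm_comm x y z w :
  uniq [:: x; y; z; w] -> (tperm x y * tperm z w = tperm z w * tperm x y)%g.
Proof.
rewrite /= !inE !negb_or => /and4P[/and3P[_ xz xw] /andP[yz yw] _ _].
rewrite (conjgC (tperm x y)) tpermJ [tperm _ _ x]tpermD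
  ?(eq_sym z) ?(eq_sym w) //.
by rewrite tpermD // eq_sym.
Qed.

(* [i] is the first time the [s]-cycle through [x2] meets [{a1, a2}], here in
   [a1]; the transposition [(x1 a1)] cuts off the arc from [x2] to [a1], which
   therefore misses [a2], so that [(x2 a2)] merges what [(x1 a1)] split. *)
Lemma porbits_add_pair_first s x1 x2 a1 a2 i :
    s x1 = x2 -> x1 != a1 -> a1 != a2 -> (s ^+ i)%g x2 = a1 ->
    (forall k, k < i -> (s ^+ k)%g x2 != a1 /\ (s ^+ k)%g x2 != a2) ->
  #|porbits (tperm x2 a2 * (tperm x1 a1 * s))%g| <= #|porbits s|.
Proof.
move=> sx x1a1 a12 si imin; rewrite -ltnS.
suff a2P : a2 \notin porbit (tperm x1 a1 * s)%g x2.
  by rewrite tpermC porbits_merge // porbits_tperm_le.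
(* An arc through [x1] at time [k] would be back at [x2] at time [k.+1], so [a1] would already be
   met at time [i - k.+1]. *)
have x1P k : k <= i -> (s ^+ k)%g x2 != x1.
  move=> ki; apply/eqP => skx; have ski : k < i.
    rewrite ltn_neqAle ki andbT; apply/eqP => eki.
    by move: x1a1; rewrite -skx eki si eqxx.
  have /imin[/eqP[]] : i - k.+1 < i by lia.
  rewrite -si -[in RHS](subnKC ski) expgD permM expgSr permM skx sx.
  by [].
apply/negP => /(@porbit_closed _
  (fun y => [exists k : 'I_i.+1, y == (s ^+ k)%g x2])).
case/(_ _ _)/existsP.
- move=> y /existsP[[k /= ki] /eqP ->]; apply/existsP.
  rewrite permM; move: ki; rewrite ltnS leq_eqVlt => /predU1P[ki|ki].
    by exists ord0; rewrite ki si tpermR sx perm1.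
  exists (Ordinal (ki : k.+1 < i.+1)); rewrite /= expgSr permM tpermD //.
    by rewrite eq_sym x1P // ltnW.
  by rewrite eq_sym; case: (imin _ ki).
- by apply/existsP; exists ord0; rewrite perm1.
case=> k /= ki /eqP a2E; move: ki; rewrite ltnS leq_eqVlt => /predU1P[ki|ki].
  by move: a12; rewrite a2E ki si eqxx.
by have [_] := imin _ ki; rewrite -a2E eqxx.
Qed.

(** If [a1] is off the cycle of [x1] and [x2], the first transposition merges and the second splits
    at most once. Otherwise [x1] is paired with whichever of [a1], [a2] the cycle meets first after
    [x1]. *)
Lemma porbits_add_pair s x1 x2 a1 a2 :
    s x1 = x2 -> x1 != a1 -> x1 != a2 -> a1 != a2 ->
  (#|porbits (tperm x2 a2 * (tperm x1 a1 * s))%g| <= #|porbits s|) \/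
  (#|porbits (tperm x2 a1 * (tperm x1 a2 * s))%g| <= #|porbits s|).
Proof.
move=> sx x1a1 x1a2 a12.
have [/porbitP[j sj]|a1P] := boolP (a1 \in porbit s x2); last first.
  left; apply: leq_trans (porbits_tperm_le _ _ _) _.
  rewrite porbits_merge // porbit_sym.
  apply: contra a1P => a1P; apply: porbit_trans a1P _.
  by rewrite porbit_sym -sx porbit_step.
have [|i] :=
  @ex_minnP (fun k => ((s ^+ k)%g x2 == a1) || ((s ^+ k)%g x2 == a2)).
  by exists j; rewrite sj eqxx.
move=> Pi imin.
have {}imin k : k < i -> (s ^+ k)%g x2 != a1 /\ (s ^+ k)%g x2 != a2.
  rewrite ltnNge => ki; apply/andP; rewrite -negb_or.
  by apply: contra ki => /imin.
have [/eqP si|/eqP si] := orP Pi.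
  by left; apply: porbits_add_pair_first si _.
right; apply: porbits_add_pair_first si _ => //; first by rewrite eq_sym.
by move=> k /imin[].
Qed.

End Cycles.

(** * Extending a permutation along an injection *)

Lemma ext_perm (T T' : finType) (f : T -> T') (f_inj : injective f)
    (s : {perm T}) :
  {s' : {perm T'} | (forall x, s' (f x) = f (s x)) &
                    (forall y, y \notin codom f -> s' y = y)}.
Proof.
pose g y := if [pick x | f x == y] is Some x then f (s x) else y.
have gf x : g (f x) = f (s x).
  rewrite /g; case: pickP => [x' /eqP/f_inj -> //|/(_ x)].
  by rewrite eqxx.
have gN y : y \notin codom f -> g y = y.
  rewrite /g; case: pickP => // x /eqP <-.
  by rewrite codom_f.
have g_inj : injective g.
  move=> y z; have [/codomP[x ->]|yf] := boolP (y \in codom f);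
    have [/codomP[x' ->]|zf] := boolP (z \in codom f); rewrite ?gf ?gN //.
  - by move/f_inj/perm_inj ->.
  - by move=> E; rewrite -E codom_f in zf.
  - by move=> E; rewrite E codom_f in yf.
by exists (perm g_inj) => y *; rewrite permE ?gf ?gN.
Qed.

(** The cycles of [s'] are the images of those of [s] and one singleton for each point outside the
    image of [f]. *)
Lemma card_porbits_ext (T T' : finType) (f : T -> T') (f_inj : injective f)
    (s : {perm T}) (s' : {perm T'}) :
    (forall x, s' (f x) = f (s x)) ->
    (forall y, y \notin codom f -> s' y = y) ->
  #|porbits s'| + #|T| = #|porbits s| + #|T'|.
Proof.
move=> s'f s'N.
have s'Xf x i : (s' ^+ i)%g (f x) = f ((s ^+ i)%g x).
  by elim: i => [|i IHi]; rewrite ?perm1 // !expgSr !permM IHi s'f.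
have orbf x : porbit s' (f x) = f @: porbit s x.
  apply/setP=> y; apply/porbitP/imsetP => [[i ->]|[_ /porbitP[i ->] ->]].
    by exists ((s ^+ i)%g x); rewrite ?mem_porbit.
  by exists i.
have orbN y : y \notin codom f -> porbit s' y = [set y].
  move=> yf; apply/setP=> z; rewrite inE; apply/idP/eqP => [|->].
    by rewrite porbit_sym => /(porbit_fixed (s'N _ yf)).
  exact: porbit_id.
have -> : porbits s' =
    [set f @: (B : {set T}) | B in porbits s]
      :|: set1 @: [set y | y \notin codom f].
  apply/setP=> B; rewrite inE; apply/imsetP/orP => [[y _ ->]|].
    have [/codomP[x ->]|yf] := boolP (y \in codom f).
      by left; rewrite orbf; apply/imset_f/imset_f.
    by right; rewrite orbN //; apply: imset_f; rewrite inE.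
  case=> /imsetP[].
    by move=> _ /imsetP[x _ ->] ->; exists (f x).
  by move=> y; rewrite inE => yf ->; exists y; rewrite ?orbN.
rewrite cardsU (card_imset _ (imset_inj f_inj)) (card_imset _ set1_inj).
have -> : #|[set f @: (B : {set T}) | B in porbits s]
             :&: set1 @: [set y | y \notin codom f]| = 0.
  apply/eqP; rewrite cards_eq0 -subset0; apply/subsetP => B.
  rewrite !inE => /andP[/imsetP[_ /imsetP[x _ ->] ->]].
  case/imsetP=> y; rewrite inE => yf E; case/negP: yf.
  have : f x \in [set y] by rewrite -E imset_f // porbit_id.
  by rewrite inE => /eqP <-; apply: codom_f.
have -> : #|[set y | y \notin codom f]| = #|[predC codom f]|.
  by apply: eq_card => y; rewrite !inE.
rewrite subn0 addnAC -addnA -(card_codom f_inj); congr (_ + _).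
exact: cardC.
Qed.

(** * Rotation systems with half-edges *)

Lemma set_ind_U1 (T : finType) (P : {set T} -> Prop) :
    P set0 -> (forall x (A : {set T}), x \notin A -> P A -> P (x |: A)) ->
  forall A, P A.
Proof.
move=> P0 PU A; have [n] := ubnP #|A|; elim: n A => // n IHn A.
have [->//|[x xA]] := set_0Vmem A.
rewrite (cardsD1 x) xA ltnS => An; rewrite -(setD1K xA).
by apply: PU; [rewrite !inE eqxx | apply: IHn].
Qed.

Section Flip.
Variable G : graph.
Implicit Types (E : {set edge G}) (rho : {perm dart G}) (x y : dart G).

Lemma same_edge x y : y.1 = x.1 -> y = x \/ y = opp x.
Proof.
case: x y => [e b] [f c] /= ->; rewrite /opp /=.
by case: b c => [] []; auto.
Qed.

Lemma opp_neq x : opp x != x.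
Proof. by apply/eqP => /(congr1 snd) /=; case: x.2. Qed.

Definition flip_fun E x := if x.1 \in E then opp x else x.

Lemma flip_funK E : involutive (flip_fun E).
Proof. move=> x; rewrite /flip_fun; case: (boolP (x.1 \in E)) => xE /=.
  by rewrite xE oppK.
by rewrite (negPf xE). Qed.

(* The graph in which only the edges of [E] are present: the other darts
   remain as half-edges in the rotation, which affects no face except those of
   vertices that become isolated, and these then get exactly one face. *)
Definition flip E : {perm dart G} := perm (inv_inj (flip_funK E)).

Lemma flipE E x : flip E x = if x.1 \in E then opp x else x.
Proof. by rewrite permE. Qed.

Lemma flip0 : flip set0 = 1%g.
Proof. by apply/permP => x; rewrite flipE inE perm1. Qed.

Lemma flipT : flip setT = perm (can_inj (@oppK G)).
Proof. by apply/permP => x; rewrite flipE inE permE. Qed.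

Lemma flipU1 E x :
  x.1 \notin E -> flip (x.1 |: E) = (tperm x (opp x) * flip E)%g.
Proof.
move=> xE; apply/permP => y; rewrite permM !flipE.
case: tpermP => [->|->|yx yox].
- by rewrite /= !inE eqxx (negPf xE).
- by rewrite /= !inE eqxx (negPf xE) oppK.
- rewrite !inE; have /negPf -> // : y.1 != x.1.
  by apply/eqP => /same_edge[].
Qed.

Lemma card_porbits_flipU E E' rho :
  #|porbits (flip (E' :|: E) * rho)%g| <= #|porbits (flip E * rho)%g| + #|E'|.
Proof.
elim/set_ind_U1: E' => [|e E' eE' IHE]; first by rewrite set0U; lia.
rewrite cardsU1 eE' -setUA; have [eE|eE] := boolP (e \in E' :|: E).
  have /setUidPr -> : [set e] \subset E' :|: E by rewrite sub1set.
  by lia.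
rewrite (@flipU1 _ (e, false) eE) -mulgA.
by apply: leq_trans (porbits_tperm_le _ _ _) _; rewrite addnS ltnS.
Qed.

Lemma odd_porbits_flip E rho :
  odd #|porbits (flip E * rho)%g| = odd #|porbits rho| (+) odd #|E|.
Proof.
elim/set_ind_U1: E => [|e E eE IHE]; first by rewrite flip0 mul1g cards0 addbF.
rewrite (@flipU1 E (e, false) eE) -mulgA cardsU1 eE oddD /=.
have := congr1 odd
  (porbits_mul_tperm (flip E * rho)%g (e, false) (opp (e, false))).
rewrite /= eq_sym opp_neq !oddD odd_double addbF => ->.
by rewrite IHE addbN -addbT.
Qed.

Lemma rotationP rho :
  reflect (forall x y, (y \in porbit rho x) = (src y == src x))
          (rotation_system rho).
Proof.
apply: (iffP forallP) => [rot x y|rot x].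
  by rewrite (eqP (rot x)) inE.
by apply/eqP/setP => y; rewrite rot inE.
Qed.

Lemma src_rotation rho x : rotation_system rho -> src (rho x) = src x.
Proof. by move/rotationP => rot; apply/eqP; rewrite -rot porbit_step. Qed.

Lemma rotation_conj rho (t : {perm dart G}) :
    (forall x, src (t x) = src x) -> rotation_system rho ->
  rotation_system (rho ^ t)%g.
Proof.
move=> tsrc /rotationP rot; apply/rotationP => x y.
by rewrite -[x](permKV t) -[y](permKV t) mem_porbit_conj rot !tsrc.
Qed.

(** The cycles of a rotation system are the nonempty fibres of [src], one for each vertex of
    positive degree. *)
Lemma card_porbits_rotation rho :
  rotation_system rho ->
  #|porbits rho| + #|[set v : vert G | deg v == 0]| = #|vert G|.
Proof.
move=> /rotationP rot.
pose fib v := [set x : dart G | src x == v].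
have fib_inj : {in [set v | deg v != 0] &, injective fib}.
  move=> u v; rewrite !inE /deg -lt0n card_gt0 => /set0Pn[x xu] _ /setP/(_ x).
  by move: xu; rewrite !inE => /eqP <-; rewrite eqxx => /esym/eqP.
have -> : porbits rho = fib @: [set v | deg v != 0].
  apply/setP => B; apply/imsetP/imsetP => [[x _ ->]|[v]].
    exists (src x); last by apply/setP => y; rewrite rot inE.
    by rewrite inE /deg -lt0n card_gt0; apply/set0Pn; exists x; rewrite inE.
  rewrite inE /deg -lt0n card_gt0 => /set0Pn[x]; rewrite inE => /eqP xv ->.
  by exists x => //; apply/setP => y; rewrite rot inE xv.
rewrite card_in_imset // -(cardsC [set v | deg v != 0]); congr (_ + _).
by apply: eq_card => v; rewrite !inE negbK.
Qed.

(** Each edge is one transposition and flips the parity of the number of cycles. This makes the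
    halving exact when a genus is read off Euler's formula. *)
Lemma odd_euler rho :
  rotation_system rho -> ~~ odd (#|vert G| + nfaces rho + #|edge G|).
Proof.
move=> rot; rewrite /nfaces /face_perm -flipT -(card_porbits_rotation rot).
rewrite !oddD odd_porbits_flip cardsT.
by case: (odd #|porbits _|); case: (odd #|edge G|); case: (odd #|_|).
Qed.

End Flip.

(** * Completing rotations, Euler's inequality and existence of embeddings *)

Section Embeddings.
Variable G : graph.
Implicit Types (E : {set edge G}) (rho s : {perm dart G}) (x y : dart G).

(* The darts fixed by both [s] and [rho] are inserted one at a time into the
   [rho]-cycle of the representative [r x]; each insertion merges two cycles of
   [rho] and two cycles of [s * rho]. *)
Lemma complete_rotation s rho (r : dart G -> dart G) :
    (forall x, src (r x) = src x) -> (forall x y, src x = src y -> r x = r y) ->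
    (forall x, src (rho x) = src x) ->
    (forall x, x \in porbit rho (r x) \/ rho x = x /\ s x = x) ->
  exists2 rho', rotation_system rho' &
    #|porbits (s * rho')%g| + #|porbits rho| =
    #|porbits (s * rho)%g| + #|porbits rho'|.
Proof.
move=> r_src r_eq; have [n] := ubnP #|porbits rho|.
elim: n rho => // n IHn rho rho_n rho_src rho_r.
have [/forallP rot|/forallPn[x xr]] := boolP [forall x, x \in porbit rho (r x)].
  exists rho => //; apply/rotationP => x y; apply/idP/eqP => [|xy].
    move=> /(@porbit_closed _ _ (fun z => src z == src x)) P; apply/eqP/P => //.
    by move=> z; rewrite rho_src.
  move: (rot y) (rot x); rewrite (r_eq _ _ xy) => yr xr.
  by apply: porbit_trans yr _; rewrite porbit_sym.
have [/idPn//|[rx sx]] := rho_r x.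
pose y := r x.
have xy : x != y by apply: contraNneq xr => {1}->; apply: porbit_id.
have xsy : x \notin porbit (s * rho)%g y.
  apply: contra xy => /porbit_fixed -> //.
  by rewrite permM sx.
have m1 := porbits_merge xr; have m2 := porbits_merge xsy.
rewrite -porbits_mulC_tperm in m1; rewrite -porbits_mulC_tperm -mulgA in m2.
(* [x] is inserted just before [y], so darts that share a cycle still share one. *)
have keep u w : w \in porbit rho u -> w \in porbit (rho * tperm x y)%g u.
  move=> /(@porbit_closed _ _ (fun z => z \in porbit (rho * tperm x y)%g u)).
  apply.
    move=> z zu; apply: porbit_trans zu.
    have [->|zx] := eqVneq z x; first by rewrite rx porbit_id.
    have := porbit_step (rho * tperm x y)%g z; rewrite permM.
    case: tpermP => [|rzy|_ _ //].
      by rewrite -{1}rx => /perm_inj/eqP; rewrite (negPf zx).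
    rewrite rzy => xz; apply: porbit_trans xz.
    by have := porbit_step (rho * tperm x y)%g x; rewrite permM rx tpermL.
  exact: porbit_id.
have [|z|z|rho' rot' E'] := IHn (rho * tperm x y)%g.
- by move: m1 rho_n; rewrite /y; lia.
- rewrite permM; case: tpermP => [zx|zy|_ _]; last exact: rho_src.
    by rewrite r_src -[RHS]rho_src zx.
  by rewrite -[RHS]rho_src zy r_src.
- have [zx|zx] := eqVneq z x.
    left; rewrite zx porbit_sym.
    by have := porbit_step (rho * tperm x y)%g x; rewrite permM rx tpermL.
  have [zr|[rz sz]] := rho_r z; first by left; apply: keep.
  have [zy|zy] := eqVneq z y.
    left; rewrite (_ : r z = z) ?porbit_id //.
    by rewrite {2}zy; apply: r_eq; rewrite zy r_src.
  by right; split=> //; rewrite permM rz tpermD // eq_sym.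
by exists rho' => //; rewrite -m1 -m2 addnS addSn E'.
Qed.

Lemma porbit_detached E rho v x y :
    rotation_system rho -> (forall z, src z = v -> z.1 \notin E) ->
  src x = v -> y \in porbit (flip E * rho)%g x -> src y = v.
Proof.
move=> rot vE xv /(@porbit_closed _ _ (fun z => src z == v)) P.
apply/eqP/P => [z /eqP zv|]; last exact/eqP.
by rewrite permM flipE (negPf (vE z zv)) src_rotation ?zv.
Qed.

(** A tree is grown edge by edge. Each new edge reaches a vertex outside [B], whose darts still form
    cycles of their own, so it merges two cycles. *)
Lemma spanning_tree rho n :
    connected G -> rotation_system rho -> n < #|vert G| ->
  exists E (B : {set vert G}),
    [/\ #|B| = n.+1, #|E| = n, forall x, x.1 \in E -> src x \in B &
        #|porbits (flip E * rho)%g| + n <= #|porbits rho|].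
Proof.
move=> [V_gt0 Gconn] rot; elim: n => [_|n IHn ltn].
  have /card_gt0P[v _] := V_gt0; exists set0, [set v].
  split; rewrite ?cards1 ?cards0 //; first by move=> x; rewrite in_set0.
  by rewrite flip0 mul1g addn0.
have [E [B [cB cE EB En]]] := IHn (ltnW ltn).
have [x xB oxB] : exists2 x, src x \in B & src (opp x) \notin B.
  have [u uB] : exists u, u \in B by apply/card_gt0P; rewrite cB.
  have [w wB] : exists w, w \notin B.
    apply/existsP; rewrite -negb_forall; apply: contraL ltn => /forallP BT.
    by rewrite -leqNgt -cB subset_leq_card //; apply/subsetP.
  have [/existsP[x /andP[]]|/existsPn nx] :=
    boolP [exists x : dart G, (src x \in B) && (src (opp x) \notin B)].
    by exists x.
  (* Without an edge leaving [B], connectedness would put [w] in [B]. *)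
  have cl : closed (@adj G) B.
    move=> a b /existsP[x /andP[/eqP xa /eqP xb]]; apply/idP/idP => ?.
      by have := nx x; rewrite xa xb; case: (b \in B) => //;
        rewrite andbT => /negP.
    by have := nx (opp x); rewrite oppK xa xb; case: (a \in B) => //;
      rewrite andbT => /negP.
  by have := closed_connect cl (Gconn u w); rewrite uB (negPf wB).
have xE : x.1 \notin E by apply: contra oxB => xE; apply: EB.
exists (x.1 |: E), (src (opp x) |: B); split.
- by rewrite cardsU1 oxB cB.
- by rewrite cardsU1 xE cE.
- by move=> y; rewrite !inE => /predU1P[/same_edge[]->|/EB->];
    rewrite ?xB ?eqxx ?orbT.
rewrite flipU1 // -mulgA.
have /porbits_merge : x \notin porbit (flip E * rho)%g (opp x);
  last by move=> m; rewrite addnS -addSn m.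
apply/negP => xP; case/negP: (oxB).
rewrite -(porbit_detached rot _ (erefl _) xP) // => z zo.
by apply: contra oxB; rewrite -zo; apply: EB.
Qed.

(** The genus is nonnegative: a spanning tree leaves at most one face, and each of the other edges
    adds at most one. *)
Lemma euler_le rho :
    connected G -> rotation_system rho ->
  #|vert G| + nfaces rho <= #|edge G| + 2.
Proof.
move=> Gconn rot; have V_gt0 := Gconn.1.
have [|E [B [_ cE _ En]]] := spanning_tree (n := #|vert G|.-1) Gconn rot.
  by rewrite prednK.
have := card_porbits_flipU E (~: E) rho; rewrite setUC setUCr.
have := cardsC E; have := card_porbits_rotation rot.
by rewrite /nfaces /face_perm -flipT; lia.
Qed.

Lemma exists_embedding : connected G -> exists k, embeds_in_genus G k.
Proof.
(* [r] chooses one dart per vertex; the default never occurs, since [x] itself qualifies. The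
   identity is then completed to a rotation system. *)
move=> Gconn; pose r x := odflt x [pick y | src y == src x].
have [x|x y xy|x|x|rho rot _] := @complete_rotation 1%g 1%g r.
- by rewrite /r; case: pickP => //= y /eqP.
- rewrite /r xy; by case: pickP => //= /(_ y); rewrite eqxx.
- by rewrite perm1.
- by right; rewrite !perm1.
exists (#|edge G| + 2 - (#|vert G| + nfaces rho))./2.
apply/existsP; exists rho; rewrite rot; apply/eqP.
by have := odd_euler rot; have := euler_le Gconn rot; lia.
Qed.

(** * Attaching a vertex along its rotation *)

(** Half-edges are fixed by [flip E], so conjugating by their exchange alters the rotation only. *)
Lemma flip_conj_tperm E x y :
  x.1 \notin E -> y.1 \notin E -> (flip E ^ tperm x y)%g = flip E.
Proof.
move=> xE yE; apply/permP => z; rewrite -[z](permKV (tperm x y)).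
move: ((tperm x y)^-1%g z) => w; rewrite permJ.
have fx : flip E x = x by rewrite flipE (negPf xE).
have fy : flip E y = y by rewrite flipE (negPf yE).
case: (tpermP x y w) => [->|->|wx wy].
- by rewrite fx fy tpermL.
- by rewrite fx fy tpermR.
- rewrite tpermD //; apply/eqP => Ew; [case: wx | case: wy];
    by apply: (@perm_inj _ (flip E)); rewrite -Ew ?fx ?fy.
Qed.

(* Two darts that follow each other at [v] are attached together, possibly
   after exchanging their positions in the rotation. *)
Lemma attach_darts v (l : seq (dart G)) E rho :
    rotation_system rho ->
    (forall x, x \in l -> [/\ src x = v, src (opp x) != v & x.1 \notin E]) ->
    uniq l -> sorted (frel rho) l ->
  exists2 rho', rotation_system rho' &
    #|porbits (flip ([set x.1 | x in l] :|: E) * rho')%g| <=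
    #|porbits (flip E * rho)%g| + odd (size l).
Proof.
have [n] := ubnP (size l); elim: n l E rho => // n IHn.
case=> [|x1 [|x2 l]] E rho ln rot lP lU lS.
- exists rho => //; rewrite (_ : [set _ | _ in _] = set0) ?set0U ?addn0 //.
  by apply/setP => e; rewrite inE; apply/imsetP => -[].
- exists rho => //; apply: leq_trans (card_porbits_flipU _ _ _) _.
  rewrite leq_add2l; apply: leq_trans (leq_imset_card _ _) _.
  by rewrite (card_uniqP _).
have [x1v o1v x1E] := lP x1 (mem_head _ _).
have [|x2v o2v x2E] := lP x2; first by rewrite !inE eqxx orbT.
move: lU; rewrite /= !inE !negb_or => /and3P[/andP[x12 x1l] x2l lU].
have [/eqP rx12 {}lS] : rho x1 == x2 /\ sorted (frel rho) l.
  by move: lS => /= /andP[-> /path_sorted].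
have x12e : x2.1 != x1.1.
  apply/eqP => /same_edge[E12|E12]; first by rewrite E12 eqxx in x12.
  by rewrite -E12 x2v eqxx in o1v.
have neqo x y : src x = v -> src (opp y) != v -> x != opp y.
  by move=> xv; apply: contraNneq => <-; rewrite xv.
have o12 : opp x1 != opp x2 by rewrite (can_eq (@oppK G)).
pose E2 := x2.1 |: (x1.1 |: E).
have x2E1 : x2.1 \notin x1.1 |: E by rewrite !inE negb_or x12e.
have lE2 : [set x.1 | x in x1 :: x2 :: l] :|: E = [set x.1 | x in l] :|: E2.
  apply/setP => e; rewrite !inE; apply/orP/orP.
    case=> [/imsetP[x]|->]; last by rewrite !orbT; right.
    rewrite !inE => /or3P[/eqP->|/eqP->|xl] ->; rewrite ?eqxx ?orbT; auto.
    by left; apply/imsetP; exists x.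
  case=> [/imsetP[x xl ->]|/or3P[/eqP->|/eqP->|->]]; last by right.
  - by left; apply/imsetP; exists x; rewrite // !inE xl !orbT.
  - by left; apply/imsetP; exists x2; rewrite // !inE eqxx orbT.
  - by left; apply/imsetP; exists x1; rewrite // !inE eqxx.
have l2P x : x \in l -> [/\ src x = v, src (opp x) != v & x.1 \notin E2].
  move=> xl; have [|xv ov xE] := lP x; first by rewrite !inE xl !orbT.
  split=> //; rewrite !inE !negb_or xE andbT.
  apply/andP; split; apply/eqP => /same_edge[Ex|Ex].
  - by rewrite -Ex xl in x2l.
  - by rewrite -Ex xv eqxx in o2v.
  - by rewrite -Ex xl in x1l.
  - by rewrite -Ex xv eqxx in o1v.
rewrite lE2 /= negbK.
have l_n : size l < n by apply: ltnW; rewrite -ltnS.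
have FE2 : flip E2 = (tperm x2 (opp x2) * (tperm x1 (opp x1) * flip E))%g.
  by rewrite /E2 !flipU1.
have [|||||] := @porbits_add_pair _ (flip E * rho)%g x1 x2 (opp x1) (opp x2).
- by rewrite permM flipE (negPf x1E).
- exact: neqo.
- exact: neqo.
- exact: o12.
- move=> le; have [rho' rot' le'] := IHn l E2 rho l_n rot l2P lU lS.
  exists rho' => //; apply: leq_trans le' _; rewrite leq_add2r.
  by apply: leq_trans le; rewrite FE2 !mulgA.
- move=> le; pose t := tperm x1 x2.
  have tsrc x : src (t x) = src x.
    by rewrite /t; case: tpermP => [->|->|]; rewrite ?x1v ?x2v.
  have lS' : sorted (frel (rho ^ t)%g) l.
    apply: (@sub_in_sorted _ [pred y | (y != x1) && (y != x2)] (frel rho)) lS.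
      move=> y z /andP[yx1 yx2] /andP[zx1 zx2] /= /eqP ryz.
      have ty : t y = y by rewrite /t tpermD // eq_sym.
      by rewrite -{1}ty permJ ryz /t tpermD // eq_sym.
    apply/allP => y yl /=.
    by apply/andP; split; [apply: contraNneq x1l | apply: contraNneq x2l] => <-.
  have [rho' rot' le'] := IHn l E2 _ l_n (rotation_conj tsrc rot) l2P lU lS'.
  exists rho' => //; apply: leq_trans le' _; rewrite leq_add2r.
  (* Conjugation by [t] uncrosses the two transpositions, fixes [flip E] and turns [rho] into
     [rho ^ t]. As the transpositions are disjoint they commute, which gives [flip E2 * rho ^ t]. *)
  apply: leq_trans le; rewrite -(card_porbits_conj (tperm x2 _ * _)%g t).
  rewrite !conjMg !tpermJ flip_conj_tperm // /t tpermL tpermR.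
  rewrite [tperm x1 x2 (opp x1)]tpermD ?[tperm x1 x2 (opp x2)]tpermD ?neqo //.
  rewrite FE2 !mulgA (tperm_comm (x := x1)) //= !inE !negb_or.
  by rewrite x12 o12 !neqo //= eq_sym neqo.
Qed.

Definition star (B : {set vert G}) : {set edge G} :=
  [set x.1 | x : dart G & src x \in B].

(** Since no loop sits at [v], distinct darts at [v] lie on distinct edges. *)
Lemma card_star v E :
    (forall x, src x = v -> src (opp x) != v /\ x.1 \notin E) ->
  #|star [set v] :|: E| = deg v + #|E|.
Proof.
move=> vP; rewrite cardsU (_ : star _ :&: E = set0) ?cards0 ?subn0.
  congr (_ + _); rewrite card_in_imset.
    by apply: eq_card => x; rewrite !inE.
  move=> x y; rewrite !inE => /eqP xv /eqP yv /same_edge[//|Ex].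
  by case: (vP y yv) => /eqP[]; rewrite -Ex.
apply/setP => e; rewrite !inE; apply/negP => /andP[/imsetP[x]].
by rewrite !inE => /eqP /vP[_ /negP xE] ->.
Qed.

(** The first dart merges two faces; the other [deg v - 1] darts, consecutive in the rotation, are
    attached in pairs. One is left over exactly when [deg v] is even, so [eps v = 1 + odd d] for
    [deg v = d.+1]. *)
Lemma attach_vertex v E rho :
    rotation_system rho -> 0 < deg v ->
    (forall x, src x = v -> src (opp x) != v /\ x.1 \notin E) ->
  exists2 rho', rotation_system rho' &
    #|porbits (flip (star [set v] :|: E) * rho')%g| + 2 <=
    #|porbits (flip E * rho)%g| + eps v.
Proof.
move=> rot /card_gt0P[x0]; rewrite inE => /eqP x0v vP.
have mem_tr x : (x \in traject rho x0 (deg v)) = (src x == v).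
  rewrite (_ : deg v = #|porbit rho x0|) -?porbit_traject.
    by rewrite (rotationP _ rot) x0v.
  by apply: eq_card => y; rewrite inE (rotationP _ rot) x0v.
have tr_uniq : uniq (traject rho x0 (deg v)).
  rewrite (_ : deg v = #|porbit rho x0|) ?uniq_traject_porbit //.
  by apply: eq_card => y; rewrite inE (rotationP _ rot) x0v.
have [d Ed] : exists d, deg v = d.+1.
  exists (deg v).-1; rewrite prednK //; apply/card_gt0P.
  by exists x0; rewrite inE x0v.
move: mem_tr tr_uniq; rewrite Ed trajectS.
set l := traject rho (rho x0) d => mem_tr /= /andP[x0l lU].
have [o0 x0E] := vP x0 x0v.
have [|||rho' rot' le'] := @attach_darts v l (x0.1 |: E) rho rot.
- move=> x xl; have xv : src x = v by apply/eqP; rewrite -mem_tr inE xl orbT.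
  have [ov xE] := vP x xv; split=> //; rewrite !inE negb_or xE andbT.
  apply/eqP => /same_edge[Ex|Ex]; first by rewrite -Ex xl in x0l.
  by rewrite -Ex xv eqxx in o0.
- exact: lU.
- have := fpath_traject rho x0 d.
  by rewrite /l; apply: path_sorted.
exists rho' => //.
have -> : star [set v] :|: E = [set x.1 | x in l] :|: (x0.1 |: E).
  rewrite setUA; congr (_ :|: _); apply/setP => e; rewrite !inE.
  apply/imsetP/orP => [[x]|].
    rewrite !inE -mem_tr inE => /predU1P[->|xl] ->; first by right.
    by left; apply/imsetP; exists x.
  case=> [/imsetP[x xl ->]|/eqP ->]; last by exists x0; rewrite // !inE x0v.
  by exists x => //; rewrite !inE -mem_tr inE xl orbT.
move: le'; rewrite flipU1 // -mulgA.
(* No edge at [v] is present yet, so the cycle of [x0] stays at [v], while [opp x0] lies at another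
   vertex. *)
have /porbits_merge m : x0 \notin porbit (flip E * rho)%g (opp x0).
  apply: contra o0; rewrite porbit_sym => oP.
  by rewrite (porbit_detached rot _ x0v oP) // => z /vP[].
rewrite /l size_traject /eps Ed /= -m => le'.
apply: leq_trans (leq_add le' (leqnn 2)) _.
by case: (odd d) => /=; rewrite ?addn0 ?addn1 addn2 ?addn2.
Qed.

End Embeddings.

(** * Deleting and restoring an independent set of vertices *)

Section DeletedVertices.
Variables (G : graph) (A : {set vert G}).
Notation H := (del_verts A).

Definition kept_edges : {set edge G} :=
  [set e | [forall b, endpt e b \notin A]].

Definition dart_incl (x : dart H) : dart G := (val x.1, x.2).

Lemma dart_incl_inj : injective dart_incl.
Proof. by move=> [e b] [f c] [/val_inj -> ->]. Qed.

Lemma src_dart_incl x : src (dart_incl x) = val (src x).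
Proof. by []. Qed.

Lemma mem_codom_dart_incl (x : dart G) :
  (x \in codom dart_incl) = (x.1 \in kept_edges).
Proof.
rewrite [in RHS]inE; apply/codomP/idP => [[y ->]|xP]; first exact: (valP y.1).
by exists (exist _ x.1 xP : edge H, x.2); case: x xP.
Qed.

Lemma star_kept : star A :|: kept_edges = setT.
Proof.
apply/setP => e; rewrite !inE; have [_|/forallPn[b]] :=
  boolP [forall b, endpt e b \notin A].
  by rewrite orbT.
rewrite negbK orbF => eA; apply/imsetP; exists (e, b) => //.
by rewrite inE.
Qed.

Lemma card_del_verts : #|vert H| + #|A| = #|vert G|.
Proof. by rewrite card_sig addnC -[RHS](cardC [in A]). Qed.

Lemma card_del_edges : #|edge H| = #|kept_edges|.
Proof. by rewrite card_sig; apply: eq_card => e; rewrite !inE. Qed.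

(** The darts off [G - A] start as fixed points and are then inserted without changing the faces of
    [G - A]. Each vertex of [A] gets one face, and so does each isolated vertex of [G - A], which
    [nfaces] already counts. *)
Lemma extend_rotation (rhoH : {perm dart H}) :
    (forall v : vert G, 0 < deg v) -> rotation_system rhoH ->
  exists2 rho : {perm dart G}, rotation_system rho &
    #|porbits (flip kept_edges * rho)%g| = nfaces rhoH + #|A|.
Proof.
move=> deg_gt0 rotH.
have [rho1 rho1_in rho1_out] := ext_perm dart_incl_inj rhoH.
(* Darts of [G - A] are preferred as representatives, so that the inserted darts join the existing
   cycle at their vertex. *)
pose r (x : dart G) :=
  if [pick y in codom dart_incl | src y == src x] is Some y then y
  else odflt x [pick y | src y == src x].
have face_in x : (flip kept_edges * rho1)%g (dart_incl x)
                 = dart_incl (face_perm rhoH x).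
  rewrite permM flipE -mem_codom_dart_incl codom_f /face_perm permM permE.
  by rewrite -rho1_in.
have face_out y : y \notin codom dart_incl -> (flip kept_edges * rho1)%g y = y.
  by move=> yH; rewrite permM flipE -mem_codom_dart_incl (negPf yH) rho1_out.
have [x|x y xy|x|x|rho rot Erho] :=
  @complete_rotation _ (flip kept_edges) rho1 r.
- rewrite /r; case: pickP => [y /= /andP[_ /eqP]//|_] /=.
  by case: pickP => //= y /eqP.
- rewrite /r xy; case: pickP => //= _; case: pickP => //= /(_ y).
  by rewrite eqxx.
- have [/codomP[y ->]|/rho1_out -> //] := boolP (x \in codom dart_incl).
  by rewrite rho1_in !src_dart_incl src_rotation.
- have [xH|xH] := boolP (x \in codom dart_incl); [left|right]; last first.
    by rewrite rho1_out // flipE -mem_codom_dart_incl (negPf xH).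
  rewrite /r; case: pickP => [y /= /andP[yH /eqP yx]|/(_ x)]; last first.
    by rewrite xH eqxx.
  move: yH xH yx => /codomP[y' ->] /codomP[x' ->].
  rewrite !src_dart_incl => /val_inj yx.
  have : x' \in porbit rhoH y' by rewrite (rotationP _ rotH) yx.
  case/porbitP => i ->; elim: i => [|i IHi]; first by rewrite perm1 porbit_id.
  rewrite expgSr permM -rho1_in; apply: porbit_trans IHi.
  exact: porbit_step.
exists rho => //; have F := card_porbits_ext dart_incl_inj face_in face_out.
have R := card_porbits_ext dart_incl_inj rho1_in rho1_out.
have VH := card_porbits_rotation rotH; have VG := card_porbits_rotation rot.
have V := card_del_verts; move: VG.
have -> : [set v : vert G | deg v == 0] = set0.
  by apply/setP => v; rewrite !inE; apply/negbTE; rewrite -lt0n.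
rewrite cards0 addn0 /nfaces => VG.
move: Erho F R VH VG V.
do 6! move: #|porbits _|.
by move: #|dart _| #|dart _|; lia.
Qed.

(** By independence, the edges at a new vertex [v] end outside [A]; none of them is a loop or
    already present. *)
Lemma attach_vertices (B : {set vert G}) (rho : {perm dart G}) :
    (forall v : vert G, 0 < deg v) -> independent A -> B \subset A ->
    rotation_system rho ->
  #|star B :|: kept_edges| = \sum_(v in B) deg v + #|kept_edges| /\
  exists2 rho' : {perm dart G}, rotation_system rho' &
    #|porbits (flip (star B :|: kept_edges) * rho')%g| + 2 * #|B| <=
    #|porbits (flip kept_edges * rho)%g| + \sum_(v in B) eps v.
Proof.
move=> deg_gt0 Aind + rot; elim/set_ind_U1: B => [_|v B vB IHB].
  have -> : star (set0 : {set vert G}) = set0.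
    by apply/setP => e; rewrite inE; apply/imsetP => -[x]; rewrite !inE.
  rewrite set0U !big_set0 cards0; split=> //.
  by exists rho; rewrite // muln0.
rewrite subUset sub1set => /andP[vA BA].
have [cB [rho1 rot1 le1]] := IHB BA.
have -> : star (v |: B) = star [set v] :|: star B.
  apply/setP => e; rewrite inE; apply/imsetP/orP => [[x]|].
    rewrite !inE => /orP[xv|xB] ->; [left|right]; apply/imsetP; exists x => //;
    by rewrite !inE.
  by case=> /imsetP[x xP ->]; exists x => //; move: xP; rewrite !inE => ->;
    rewrite ?orbT.
have adjP (x : dart G) : adj (src x) (src (opp x)).
  by apply/existsP; exists x; rewrite !eqxx.
have vP x : src x = v ->
    src (opp x) != v /\ x.1 \notin star B :|: kept_edges.
  move=> xv; have oxA : src (opp x) \notin A.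
    apply/negP => oxA; have := Aind _ _ vA oxA.
    by rewrite -xv adjP.
  split; first by apply: contraNneq oxA => ->.
  rewrite !inE negb_or; apply/andP; split; last first.
    by apply/forallPn; exists x.2; rewrite negbK -/(src x) xv.
  apply/imsetP => -[y]; rewrite inE => yB /esym/same_edge[Ey|Ey].
    by move: vB; rewrite -xv -Ey yB.
  by move: oxA; rewrite -Ey (subsetP BA).
rewrite -setUA (card_star vP) cB !big_setU1 //= cardsU1 vB addnA; split=> //.
have [rho2 rot2 le2] := attach_vertex rot1 (deg_gt0 v) vP.
exists rho2 => //; move: le1 le2.
by move: #|porbits _| #|porbits _| #|porbits _|; lia.
Qed.

(** Passing from [G - A] to [G] adds [#|A|] vertices, [\sum deg] edges and at most [\sum eps - #|A|]
    faces. Doubled genera and sums on both sides avoid truncated subtraction. *)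
Lemma embeds_add_vertices k :
    (forall v : vert G, 0 < deg v) -> independent A ->
    embeds_in_genus H k ->
  exists2 k', embeds_in_genus G k' &
    2 * k + \sum_(v in A) deg v <= 2 * k' + \sum_(v in A) eps v.
Proof.
move=> deg_gt0 Aind /existsP[rhoH /andP[rotH /eqP Ek]].
have [rho0 rot0 F0] := extend_rotation deg_gt0 rotH.
have [cE [rho rot]] := attach_vertices deg_gt0 Aind (subxx A) rot0.
rewrite F0 star_kept flipT -/(face_perm rho); move: cE.
rewrite star_kept cardsT => cE leF.
have VG := card_del_verts; have EH := card_del_edges.
have odd_e := odd_euler rot.
have nfE : nfaces rho = #|porbits (face_perm rho)|.
  rewrite /nfaces (_ : [set v | _] = set0) ?cards0 ?addn0 //.
  by apply/setP => v; rewrite !inE; apply/negbTE; rewrite -lt0n.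
rewrite -nfE in leF.
(* Euler's formula solved for the genus; [odd_e] makes the halving exact. *)
exists (#|edge G| + 2 - (#|vert G| + nfaces rho))./2; last first.
  move: leF cE VG EH odd_e Ek.
  move: (nfaces rho) (nfaces rhoH) (\sum_(v in A) deg v) (\sum_(v in A) eps v).
  by move: #|vert G| #|vert H| #|edge G| #|edge H| #|A| #|kept_edges|; lia.
apply/existsP; exists rho; rewrite rot; apply/eqP.
(* With [leF] and [Ek], this shows that the subtraction in the witness does not truncate. *)
have : \sum_(v in A) eps v <= \sum_(v in A) deg v.
  apply: leq_sum => v _; rewrite /eps; have := deg_gt0 v.
  by case: (deg v) => [|[|d]] // _; case: ifP.
move: leF cE VG EH odd_e Ek.
move: (nfaces rho) (nfaces rhoH) (\sum_(v in A) deg v) (\sum_(v in A) eps v).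
by move: #|vert G| #|vert H| #|edge G| #|edge H| #|A| #|kept_edges|; lia.
Qed.

End DeletedVertices.

Local Open Scope ring_scope.

Theorem theoremB (G : graph) (A : {set vert G})
    (G_connected : connected G)
    (G_mindeg : forall v : vert G, (3 <= deg v)%N)
    (A_independent : independent A)
    (GA_connected : connected (del_verts A)) :
  (max_genus G)%:R >=
    2^-1 * (\sum_(v in A) ((deg v)%:R - (eps v)%:R))
      + (max_genus (del_verts A))%:R :> rat.
Proof.
(* Some embedding of [G - A] exists, so its maximum genus is attained and can serve as the starting
   point. *)
have [k0 /(max_genus_attained GA_connected) Hk] :=
  exists_embedding GA_connected.
have deg_gt0 (v : vert G) : (0 < deg v)%N by apply: leq_trans (G_mindeg v).
have [k Gk le_k] := embeds_add_vertices deg_gt0 A_independent Hk.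
have := leq_max_genus G_connected Gk; rewrite -(ler_nat rat) => k_le.
apply: le_trans k_le; rewrite sumrB -!natr_sum mulrBr -addrAC lerBlDr.
rewrite -(@ler_pM2l _ 2) // !mulrDr !mulrA divff // !mul1r.
rewrite -!natrM -!natrD ler_nat.
by rewrite [leqLHS]addnC.
Qed.
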